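(* Let $n\ge 2$ be an integer and $\xi$ a transcendental real number. Let $2\le k\le n$ be another integer. If $w_1(\xi)>n+k-1$, then $$\overline{\kappa}_n(\xi)\ge\left(1-\frac1k\right)\cdot w_1(\xi).$$ Thus, if $w_1(\xi)>2n-1$, then $$\overline{\kappa}_n(\xi)\ge\left(1-\frac1n\right)\cdot w_1(\xi).$$ In particular, if $\xi$ is a Liouville number, then $$\overline{\kappa}_n(\xi)=\infty.$$
   Context: Let $n\ge 1$ be an integer and $\xi$ a transcendental real number. The height $H_P$ of a polynomial $P$ is the maximum modulus of its coefficients. The height $H(\alpha)$ of an algebraic number $\alpha$ is the height of its minimal polynomial over the integers with coprime coefficients. For a real parameter $X>1$, let $P_X$ be the non-zero integer polynomial of degree at most $n$ and height at most $X$ that minimizes $|P(\xi)|$ among all such polynomials $P$ (unique up to sign). Let $\alpha_X$ be the algebraic number of degree at most $n$ and height at most $X$ that minimizes $H(\alpha)\cdot|\xi-\alpha|$ among all such $\alpha$. Define $$w(n,\xi,X)=-\frac{\log|P_X(\xi)|}{\log X},\qquad w^{\ast}(n,\xi,X)=-\frac{\log\left(H(\alpha_X)\cdot|\alpha_X-\xi|\right)}{\log X},$$ $$w_n(\xi)=\limsup_{X\to\infty}w(n,\xi,X)\in[0,\infty],$$ and $$\kappa(n,\xi,X)=w(n,\xi,X)-w^{\ast}(n,\xi,X),\qquad \overline{\kappa}_n(\xi)=\limsup_{X\to\infty}\kappa(n,\xi,X).$$ $w_1(\xi)$ is $w_n(\xi)$ for $n=1$; it may equal $\infty$, in which case the right-hand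 sides are read as $\infty$. A Liouville number is a transcendental real number $\xi$ with $w_1(\xi)=\infty$. *)

(* Defs.v *)
From HB Require Import structures.
From mathcomp Require Import all_boot all_order all_algebra.
From mathcomp Require Import all_classical all_reals all_analysis.
From mathcomp Require Import complex.

Set Implicit Arguments.
Unset Strict Implicit.
Unset Printing Implicit Defensive.

Import Order.TTheory GRing.Theory Num.Theory.
Import numFieldNormedType.Exports.

Local Open Scope classical_set_scope.
Local Open Scope ring_scope.

Definition transcendental (R : realType) (xi : R) : Prop :=
  ~ algebraicOver (ratr : rat -> R) xi.

Definition poly_height (P : {poly int}) : nat :=
  (\max_(i < size P) `|(P`_i)%R|)%N.

Definition int_poly_eval (A : nzRingType) (P : {poly int}) (x : A) : A :=
  (map_poly intr P).[x].

(* Degree at most n is [size P <= n.+1]. *)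
Definition bounded_poly (R : realType) (n : nat) (X : R) : set {poly int} :=
  [set P : {poly int} | [/\ P != 0, (size P <= n.+1)%N & (poly_height P)%:R <= X]].

Definition is_best_poly (R : realType) (n : nat) (xi X : R) (P : {poly int}) :
    Prop :=
  bounded_poly n X P /\
  forall Q, bounded_poly n X Q ->
    `|int_poly_eval P xi| <= `|int_poly_eval Q xi|.

(* The minimizer P_X: for X >= 1 one exists because [bounded_poly n X] is
   finite and contains 1; the value |P_X(xi)| does not depend on the choice.
   The default 0 is only reached for X < 1. *)
Definition best_poly (R : realType) (n : nat) (xi X : R) : {poly int} :=
  xget 0 [set P | is_best_poly n xi X P].

(* [zcontents P] carries the sign of the leading coefficient, so
   [zcontents P = 1] says that the coefficients are coprime and also fixes the
   sign of P, which makes the minimal polynomial unique. *)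
Definition is_int_minpoly (R : realType) (alpha : R[i]) (P : {poly int}) :
    Prop :=
  [/\ zcontents P = 1,
      int_poly_eval P alpha = 0 &
      forall Q : {poly int}, Q != 0 -> int_poly_eval Q alpha = 0 ->
        (size P <= size Q)%N].

Definition int_minpoly (R : realType) (alpha : R[i]) : {poly int} :=
  xget 0 [set P | is_int_minpoly alpha P].

Definition alg_degree (R : realType) (alpha : R[i]) : nat :=
  (size (int_minpoly alpha)).-1.

Definition alg_height (R : realType) (alpha : R[i]) : nat :=
  poly_height (int_minpoly alpha).

Definition bounded_alg (R : realType) (n : nat) (X : R) : set R[i] :=
  [set alpha : R[i] | [/\ algebraicOver (ratr : rat -> R[i]) alpha,
                   (alg_degree alpha <= n)%N &
                   (alg_height alpha)%:R <= X]].

Definition alg_cost (R : realType) (xi : R) (alpha : R[i]) : R :=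
  (alg_height alpha)%:R * Normc.normc (alpha - xi%:C%C).

Definition is_best_alg (R : realType) (n : nat) (xi X : R) (alpha : R[i]) :
    Prop :=
  bounded_alg n X alpha /\
  forall beta, bounded_alg n X beta -> alg_cost xi alpha <= alg_cost xi beta.

(* The minimizer alpha_X: for n >= 1 and X >= 1 one exists because
   [bounded_alg n X] is finite and contains 0.  It need not be unique (complex
   conjugates), but [alg_cost xi] takes the same value at all minimizers. *)
Definition best_alg (R : realType) (n : nat) (xi X : R) : R[i] :=
  xget 0 [set alpha | is_best_alg n xi X alpha].

Definition w_at (R : realType) (n : nat) (xi X : R) : R :=
  - (ln `|int_poly_eval (best_poly n xi X) xi| / ln X).

Definition wstar_at (R : realType) (n : nat) (xi X : R) : R :=
  - (ln (alg_cost xi (best_alg n xi X)) / ln X).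

Definition kappa_at (R : realType) (n : nat) (xi X : R) : R :=
  w_at n xi X - wstar_at n xi X.

Definition w_exponent (R : realType) (n : nat) (xi : R) : \bar R :=
  limf_esup (fun X : R => (w_at n xi X)%:E) +oo%R.

Definition kappa_upper (R : realType) (n : nat) (xi : R) : \bar R :=
  limf_esup (fun X : R => (kappa_at n xi X)%:E) +oo%R.

Definition Liouville_number (R : realType) (xi : R) : Prop :=
  transcendental xi /\ w_exponent 1 xi = +oo%E.

(* Main.v *)
Require Import Defs.
From HB Require Import structures.
From mathcomp Require Import all_boot all_order all_algebra.
From mathcomp Require Import all_classical all_reals all_analysis.
From mathcomp Require Import complex.
From mathcomp Require Import zify ring lra.

Set Implicit Arguments.
Unset Strict Implicit.
Unset Printing Implicit Defensive.

Import Order.TTheory GRing.Theory Num.Theory.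
Import numFieldNormedType.Exports.

Local Open Scope ring_scope.

(** The idea is that a very good rational approximation to xi makes a power of
    a linear form small at xi, while forcing every algebraic number other than
    that rational to stay away from xi.

    Suppose w is less than w_1(xi). For arbitrarily large H there is a
    primitive linear form L = a T + b of height H with
    v = |L(xi)| < H ^ (- w) ([exists_good_linear_form]). Let
    X = (2 H) ^ k. Then L ^ k has degree k, at most n, and height at most X
    ([height_linearX]), so the smallest polynomial value at this X is at most
    v ^ k.

    On the algebraic side, every alpha of degree at most n and height at most X
    has H(alpha) |alpha - xi| >= v ([alg_cost_ge_linear_form]). If the minimal
    polynomial M of alpha vanishes at r = - b / a, then Gauss's lemma makes L a
    factor of M, so alpha = r and the bound is immediate. Otherwise
    |M(r)| >= |a| ^ (- n), since clearing denominators yields a nonzero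
    integer ([eval_fraction_ge]), while M(alpha) = 0 bounds |M(r)| by a constant
    times H(alpha) |alpha - r|. As r is within v / |a| of xi and |a| is
    comparable to H, a cost below v would give 1 <= C v H ^ (n + k - 1), where C
    depends on n, k and xi only. This fails for large H once w > n + k - 1:
    it is here that the hypothesis on w_1(xi) is used.

    Writing W = - log v, the two estimates give
    kappa(n, xi, X) >= (k W - W) / log X = (1 - 1 / k) W / log (2 H)
    ([kappa_at_ge]), and the quotient W / log (2 H) exceeds any number below w
    as soon as H is large. Letting w tend to w_1(xi) yields the first claim
    ([kappa_upper_ge], [lee_of_reals_between]); the other two are the case
    k = n. *)

(** * Heights of integer polynomials *)

Lemma coef_le_height (P : {poly int}) (i : nat) :
  (`|(P`_i)%R| <= poly_height P)%N.
Proof.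
have [lei|lti] := leqP (size P) i; first by rewrite nth_default.
exact: (leq_bigmax_cond (F := fun i : 'I__ => `|(P`_i)%R|%N) (Ordinal lti)).
Qed.

Lemma height_le (P : {poly int}) (N : nat) :
  (forall i, (`|(P`_i)%R| <= N)%N) -> (poly_height P <= N)%N.
Proof. by move=> PN; apply/bigmax_leqP => i _; apply: PN. Qed.

Lemma height_gt0 (P : {poly int}) : P != 0 -> (0 < poly_height P)%N.
Proof.
move=> P0; apply: leq_trans (coef_le_height P (size P).-1).
by rewrite absz_gt0 -lead_coefE lead_coef_eq0.
Qed.

Lemma height_zprimitive (P : {poly int}) :
  (poly_height (zprimitive P) <= poly_height P)%N.
Proof.
have [->|P0] := eqVneq P 0; first by rewrite zprimitive0.
apply: height_le => i; apply: leq_trans (coef_le_height P i).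
rewrite [in leqRHS](zpolyEprim P) coefZ abszM leq_pmull //.
by rewrite absz_gt0 zcontents_eq0.
Qed.

(** Each coefficient of the product is a sum of at most two products of
    coefficients, whence the factor 2. *)
Lemma height_linearM (L Q : {poly int}) : (size L <= 2)%N ->
  (poly_height (L * Q) <= 2 * poly_height L * poly_height Q)%N.
Proof.
move=> sL; apply: height_le => i.
set H := (2 * poly_height _ * _)%N.
have eL : L = L`_1 *: 'X + (L`_0)%:P.
  apply/polyP => -[|[|j]]; rewrite coefD coefZ coefX coefC /= ?mulr0 ?mulr1;
    rewrite ?add0r ?addr0 //.
  by rewrite nth_default //; apply: leq_trans sL _.
have -> : (L * Q)`_i = L`_1 * (if i == 0%N then 0 else Q`_i.-1) + L`_0 * Q`_i.
  by rewrite {1}eL mulrDl coefD -scalerAl coefZ coefXM coefCM.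
apply: leq_trans (_ : (`|(L`_1 * (if i == 0%N then 0 else Q`_i.-1))%R| +
   `|(L`_0 * Q`_i)%R| <= H)%N); first by lia.
rewrite /H mul2n -addnn mulnDl !abszM; apply: leq_add; apply: leq_mul;
  rewrite ?coef_le_height //; case: eqP => // _; exact: coef_le_height.
Qed.

Lemma height_linearX (L : {poly int}) (k : nat) : (size L <= 2)%N ->
  (poly_height (L ^+ k) <= (2 * poly_height L) ^ k)%N.
Proof.
move=> sL; elim: k => [|k IHk].
  apply: height_le => i; rewrite expr0 expn0 coefC; by case: eqP.
rewrite exprS expnS; apply: leq_trans (height_linearM _ sL) _.
by rewrite leq_mul2l IHk orbT.
Qed.

Lemma size_linearX (L : {poly int}) (k : nat) :
  (size L <= 2)%N -> (size (L ^+ k) <= k.+1)%N.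
Proof.
move=> sL; apply: leq_trans (size_poly_exp_leq _ _) _.
rewrite ltnS; have : ((size L).-1 <= 1)%N by lia.
by move=> h; rewrite -[leqRHS]mul1n leq_mul2r h orbT.
Qed.

(** * Values of integer polynomials *)

Lemma int_poly_evalE (A : nzRingType) (P : {poly int}) (x : A) (n : nat) :
  (size P <= n)%N -> int_poly_eval P x = \sum_(i < n) (P`_i)%:~R * x ^+ i.
Proof.
move=> sP; rewrite /int_poly_eval (@horner_coef_wide _ n).
  by apply: eq_bigr => i _; rewrite coef_map.
exact: leq_trans (size_poly _ _) sP.
Qed.

Lemma int_poly_evalM (A : comNzRingType) (P Q : {poly int}) (x : A) :
  int_poly_eval (P * Q) x = int_poly_eval P x * int_poly_eval Q x.
Proof. by rewrite /int_poly_eval rmorphM hornerM. Qed.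

Lemma int_poly_evalX (A : comNzRingType) (P : {poly int}) (k : nat) (x : A) :
  int_poly_eval (P ^+ k) x = int_poly_eval P x ^+ k.
Proof. by rewrite /int_poly_eval rmorphXn horner_exp. Qed.

Lemma int_poly_evalZ (A : comNzRingType) (c : int) (P : {poly int}) (x : A) :
  int_poly_eval (c *: P) x = c%:~R * int_poly_eval P x.
Proof. by rewrite /int_poly_eval map_polyZ hornerZ. Qed.

Lemma int_poly_eval_rmorph (A B : nzRingType) (f : {rmorphism A -> B})
    (P : {poly int}) (x : A) : int_poly_eval P (f x) = f (int_poly_eval P x).
Proof.
rewrite !(int_poly_evalE _ (leqnn _)) rmorph_sum; apply: eq_bigr => i _.
by rewrite rmorphM rmorphXn rmorph_int.
Qed.

Lemma norm_int_ge1 (A : numDomainType) (c : int) :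
  c != 0 -> 1 <= `|c%:~R : A|.
Proof. by move=> c0; rewrite -intr_norm ler1z; lia. Qed.

Lemma eval_zprimitive_le (A : numDomainType) (P : {poly int}) (x : A) :
  `|int_poly_eval (zprimitive P) x| <= `|int_poly_eval P x|.
Proof.
have [->|P0] := eqVneq P 0; first by rewrite zprimitive0.
rewrite [in leRHS](zpolyEprim P) int_poly_evalZ normrM ler_peMl //.
by rewrite norm_int_ge1 // zcontents_eq0.
Qed.

Lemma norm_coef_le (A : numDomainType) (P : {poly int}) (i : nat) :
  `|(P`_i)%:~R : A| <= (poly_height P)%:R.
Proof.
by rewrite -intr_norm -natr_absz ler_nat coef_le_height.
Qed.

Lemma norm_subX_le (A : numDomainType) (B x y : A) (i : nat) :
  `|x| <= B -> `|y| <= B ->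
  `|x ^+ i.+1 - y ^+ i.+1| <= i.+1%:R * B ^+ i * `|x - y|.
Proof.
move=> xB yB; rewrite subrXX normrM mulrC; apply: ler_wpM2r => //.
apply: le_trans (ler_norm_sum _ _ _) _.
rewrite -[i.+1 in leRHS]card_ord mulr_natl -sumr_const.
apply: ler_sum => j _; rewrite normrM !normrX.
have -> : B ^+ i = B ^+ (i - j) * B ^+ j by rewrite -exprD subnK ?leq_ord.
by apply: ler_pM;
  rewrite ?exprn_ge0 ?lerXn2r // nnegrE ?normr_ge0 // (le_trans _ xB).
Qed.

(** The derivative of a polynomial of degree at most n with coefficients in the
    unit ball, bounded term by term on the ball of radius B. *)
Definition lipschitz_bound (A : numDomainType) (n : nat) (B : A) : A :=
  \sum_(i < n) i.+1%:R * B ^+ i.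

Lemma eval_lipschitz (A : numDomainType) (n : nat) (P : {poly int})
    (B x y : A) :
    (size P <= n.+1)%N -> `|x| <= B -> `|y| <= B ->
  `|int_poly_eval P x - int_poly_eval P y|
    <= (poly_height P)%:R * lipschitz_bound n B * `|x - y|.
Proof.
move=> sP xB yB; rewrite !(int_poly_evalE _ sP) -sumrB big_ord_recl /=.
rewrite !expr0 subrr add0r; apply: le_trans (ler_norm_sum _ _ _) _.
rewrite /lipschitz_bound mulr_sumr mulr_suml; apply: ler_sum => i _.
rewrite -mulrBr normrM -mulrA; apply: ler_pM => //; first exact: norm_coef_le.
exact: norm_subX_le.
Qed.

(** Liouville's inequality for rationals: clearing the denominators in P(b / a)
    leaves a nonzero integer. *)
Lemma eval_fraction_ge (A : numFieldType) (n : nat) (P : {poly int})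
    (a b : int) :
    a != 0 -> (size P <= n.+1)%N ->
    int_poly_eval P (b%:~R / a%:~R : A) != 0 ->
  1 <= `|int_poly_eval P (b%:~R / a%:~R : A)| * `|a%:~R| ^+ n.
Proof.
move=> a0 sP P0; have a0' : a%:~R != 0 :> A by rewrite intr_eq0.
have E : int_poly_eval P (b%:~R / a%:~R : A) * a%:~R ^+ n =
    (\sum_(i < n.+1) P`_i * b ^+ i * a ^+ (n - i))%:~R.
  rewrite (int_poly_evalE _ sP) mulr_suml rmorph_sum; apply: eq_bigr => i _ /=.
  have -> : (a%:~R : A) ^+ n = a%:~R ^+ (n - i) * a%:~R ^+ i.
    by rewrite -exprD subnK ?leq_ord.
  rewrite !rmorphM !rmorphXn /= exprMn exprVn.
  by field; rewrite expf_neq0.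
rewrite -normrX -normrM E; apply: norm_int_ge1.
by rewrite -(intr_eq0 A) -E mulf_neq0 ?expf_neq0.
Qed.

(** * Minimal polynomials and the minimizing polynomial *)

(** Clearing denominators replaces a rational annihilating polynomial by an
    integer one. *)
Lemma algebraic_int_root (A : numFieldType) (x : A) :
  algebraicOver (ratr : rat -> A) x <->
  exists2 P : {poly int}, P != 0 & int_poly_eval P x = 0.
Proof.
split=> [[p p0 px]|[P P0 Px]]; last first.
  exists (map_poly intr P).
    apply: contra_neq P0 => PQ0; apply: (@map_inj_poly _ _ (intr : int -> rat)).
    - exact: intr_inj.
    - by rewrite rmorph0.
    - by rewrite PQ0 rmorph0.
  rewrite /root -map_poly_comp /=.
  have -> : map_poly ((ratr : rat -> A) \o intr) P = map_poly intr P.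
    by apply: eq_map_poly => c /=; rewrite ratr_int.
  exact/eqP.
have [q [a a0 pE]] := rat_poly_scale p.
exists q; first by apply: contraNneq p0 => q0; rewrite pE q0 rmorph0 scaler0.
have a0' : (a%:~R : A) != 0 by rewrite intr_eq0.
move: px; rewrite pE /root map_polyZ hornerZ -map_poly_comp mulf_eq0.
rewrite fmorph_eq0 invr_eq0 intr_eq0 (negPf a0) /= .
have -> : map_poly ((ratr : rat -> A) \o intr) q = map_poly intr q.
  by apply: eq_map_poly => c /=; rewrite ratr_int.
by move/eqP.
Qed.

Lemma transcendental_eval_neq0 (R : realType) (xi : R) (P : {poly int}) :
  transcendental xi -> P != 0 -> int_poly_eval P xi != 0.
Proof.
move=> tr P0; apply/eqP => Px; apply: tr.
by apply/algebraic_int_root; exists P.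
Qed.

(** The primitive part of an integer annihilating polynomial of least size
    qualifies, so the chosen minimal polynomial is never the default 0. *)
Lemma int_minpolyP (R : realType) (alpha : R[i]) :
  algebraicOver (ratr : rat -> R[i]) alpha ->
  is_int_minpoly alpha (int_minpoly alpha).
Proof.
move=> /algebraic_int_root[P0 P0n0 P0r]; apply: (xgetPex 0%R).
pose S m := `[< exists P : {poly int},
  [/\ P != 0, int_poly_eval P alpha = 0 & size P = m] >].
have exS : exists m, S m by exists (size P0); apply/asboolP; exists P0.
have [m /asboolP[Q [Qn0 Qr sQ]] mmin] := ex_minnP exS.
exists (zprimitive Q); split.
- by rewrite zcontents_primitive Qn0.
- apply/eqP; move: Qr; rewrite (zpolyEprim Q) int_poly_evalZ zprimitiveZ.
    rewrite zprimitive_id => /eqP; rewrite mulf_eq0 intr_eq0 zcontents_eq0.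
    by rewrite (negPf Qn0).
  by rewrite zcontents_eq0.
- move=> T Tn0 Tr; rewrite size_zprimitive sQ; apply: mmin.
  by apply/asboolP; exists T.
Qed.

Lemma size_int_minpoly (R : realType) (alpha : R[i]) (n : nat) :
  (alg_degree alpha <= n)%N -> (size (int_minpoly alpha) <= n.+1)%N.
Proof. by rewrite /alg_degree; case: size. Qed.

Lemma int_minpoly_neq0 (R : realType) (alpha : R[i]) (M : {poly int}) :
  is_int_minpoly alpha M -> M != 0.
Proof. by case=> c1 _ _; apply: contra_eq_neq c1 => ->; rewrite zcontents0. Qed.

Lemma linear_eval (A : comNzRingType) (L : {poly int}) (x : A) :
  (size L <= 2)%N -> int_poly_eval L x = (L`_1)%:~R * x + (L`_0)%:~R.
Proof.
move=> sL; rewrite (int_poly_evalE _ sL) !big_ord_recl big_ord0 /=.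
by rewrite expr0 expr1 mulr1 addr0 addrC.
Qed.

Lemma linear_lead_neq0 (L : {poly int}) : size L = 2 -> L`_1 != 0.
Proof.
move=> sL; have := lead_coef_eq0 L; rewrite lead_coefE sL => ->.
by rewrite -size_poly_gt0 sL.
Qed.

(** Over the rationals L divides M because they share the root - b / a; since L
    is primitive, Gauss's lemma moves the divisibility to integer
    polynomials. *)
Lemma primitive_linear_dvd (L M : {poly int}) : size L = 2 -> zcontents L = 1 ->
  int_poly_eval M (- (L`_0)%:~R / (L`_1)%:~R : rat) = 0 -> exists N, M = L * N.
Proof.
move=> sL cL Mr; have a0 := linear_lead_neq0 sL.
have a0' : (L`_1)%:~R != 0 :> rat by rewrite intr_eq0.
have primL : zprimitive L = L by rewrite [RHS](zpolyEprim L) cL scale1r.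
suff : (L %| M)%R by move=> /dvdpP_int[N]; rewrite primL => ->; exists N.
rewrite -dvdp_rat_int.
have -> : map_poly intr L =
    (L`_1)%:~R *: ('X - (- (L`_0)%:~R / (L`_1)%:~R)%:P) :> {poly rat}.
  apply/polyP => i; rewrite coef_map coefZ coefB coefX coefC /=.
  case: i => [|[|i]] /=; rewrite ?subr0 ?mulr1 //.
    by rewrite sub0r; field.
  by rewrite nth_default ?sL // mulr0.
by rewrite dvdpZl // dvdp_XsubCl /root -/(int_poly_eval _ _) Mr.
Qed.

(** By minimality alpha is a root of L rather than of the cofactor N, and then
    N is a nonzero constant, which can only enlarge the coefficients of L. *)
Lemma minpoly_linear_factor (R : realType) (alpha : R[i]) (L N : {poly int}) :
    size L = 2 -> is_int_minpoly alpha (L * N) ->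
  int_poly_eval L alpha = 0 /\ (poly_height L <= poly_height (L * N))%N.
Proof.
move=> sL mM; have M0 := int_minpoly_neq0 mM; case: mM => _ Mr Mmin.
have L0 : L != 0 by rewrite -size_poly_gt0 sL.
have N0 : N != 0 by apply: contraNneq M0 => ->; rewrite mulr0.
have sM : size (L * N) = (size N).+1 by rewrite size_mul // sL.
have Lr : int_poly_eval L alpha = 0.
  move/eqP: Mr; rewrite int_poly_evalM mulf_eq0 => /orP[/eqP //|/eqP Nr].
  by have := Mmin _ N0 Nr; rewrite sM ltnn.
split=> //; have := Mmin _ L0 Lr; rewrite sM sL ltnS => sN.
have [c c0 ->] : exists2 c, c != 0 & N = c%:P.
  exists (N`_0); last exact: size1_polyC.
  by apply: contraNneq N0 => c0; rewrite (size1_polyC sN) c0.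
apply: height_le => i; apply: leq_trans (coef_le_height _ i).
by rewrite coefMC abszM leq_pmulr // absz_gt0.
Qed.

(** Only finitely many polynomials compete, so a minimizer exists: they are
    enumerated by the finite functions giving their coefficients shifted by N to
    be nonnegative, where N is the integer part of X. *)
Lemma best_polyP (R : realType) (n : nat) (xi X : R) :
  1 <= X -> is_best_poly n xi X (best_poly n xi X).
Proof.
move=> X1; apply: (xgetPex 0%R).
set N := Num.truncn X.
have X0 : 0 <= X by apply: le_trans X1.
have leN h : (h%:R <= X) = (h <= N)%N by rewrite truncn_ge_nat.
pose enc := {ffun 'I_n.+1 -> 'I_(2 * N).+1}.
pose dec (f : enc) : {poly int} := \poly_(i < n.+1) ((f (inord i))%:Z - N%:Z).
have decP P : bounded_poly n X P -> exists f, P = dec f.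
  move=> [_ sP]; rewrite leN => hP.
  have hc i : (`|(P`_i)%R| <= N)%N := leq_trans (coef_le_height P i) hP.
  exists [ffun i : 'I_n.+1 => inord `|P`_i + N%:Z|]; apply/polyP => i.
  rewrite coef_poly; case: ltnP => [ltin|lein]; last first.
    by rewrite nth_default // (leq_trans sP).
  by rewrite ffunE inordK ?inordK //; have := hc i; lia.
have b1 : bounded_poly n X 1.
  split; rewrite ?oner_neq0 ?size_poly1 //.
  apply: le_trans X1; rewrite lern1; apply: height_le => i.
  by rewrite coef1; case: eqP.
have [f0 f0E] := decP _ b1.
have b0 : `[< bounded_poly n X (dec f0) >] by apply/asboolP; rewrite -f0E.
have [f /asboolP fb fmin] := @Order.TotalTheory.arg_minP _ _ _ f0
  (fun f => `[< bounded_poly n X (dec f) >])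
  (fun f => `|int_poly_eval (dec f) xi|) b0.
exists (dec f); split=> // Q bQ; have [g gE] := decP _ bQ.
by rewrite gE; apply: fmin; apply/asboolP; rewrite -gE.
Qed.

(** * The gap around a good rational approximation *)

Lemma normr_complexE (R : realType) (z : R[i]) : `|z| = (Normc.normc z)%:C%C.
Proof. by []. Qed.

Lemma normc_real (R : realType) (x : R) : Normc.normc x%:C%C = `|x|.
Proof. by rewrite /Normc.normc /= expr0n /= addr0 sqrtr_sqr. Qed.

Lemma lipschitz_bound_gt0 (R : realType) (n : nat) (B : R) :
  (0 < n)%N -> 0 < B -> 0 < lipschitz_bound n B.
Proof.
case: n => // n _ B0; rewrite /lipschitz_bound big_ord_recl /= expr0 mulr1.
by rewrite ltr_pwDl // sumr_ge0 // => i _;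
  rewrite mulr_ge0 ?ler0n ?exprn_ge0 ?ltW.
Qed.

(** An algebraic number close to x forces its annihilating polynomials to be
    small at x; the estimate is made at complex points since alpha need not be
    real. *)
Lemma eval_near_root (R : realType) (n : nat) (P : {poly int}) (B x : R)
    (alpha : R[i]) :
    (size P <= n.+1)%N -> int_poly_eval P alpha = 0 ->
    `|x| <= B -> Normc.normc alpha <= B ->
  `|int_poly_eval P x|
    <= (poly_height P)%:R * lipschitz_bound n B * Normc.normc (alpha - x%:C%C).
Proof.
move=> sP Pr xB aB; rewrite -lecR -[in leLHS]normc_real -normr_complexE.
rewrite -int_poly_eval_rmorph -[X in `|X|]subr0 -Pr.
have xB' : `|x%:C%C| <= B%:C%C by rewrite normr_complexE lecR normc_real.
have aB' : `|alpha| <= B%:C%C by rewrite normr_complexE lecR.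
apply: le_trans (eval_lipschitz sP xB' aB') _.
rewrite distrC !rmorphM /= rmorph_nat /lipschitz_bound rmorph_sum /=.
rewrite le_eqVlt; apply/orP; left; apply/eqP; congr (_ * _ * _).
by apply: eq_bigr => i _; rewrite rmorphM rmorphXn rmorph_nat.
Qed.

(** The factor 2 ^ k comes from the height bound (2 H) ^ k, one more factor 2
    from the two terms of |alpha - xi| + |xi - r|, and 1 + |xi| from comparing
    the height of a linear form with its leading coefficient. The radius
    |xi| + 2 leaves room for all points within distance 1 of xi. *)
Definition gap_constant (R : realType) (n k : nat) (xi : R) : R :=
  lipschitz_bound n (`|xi| + 2) * 2 ^+ k.+1 * (1 + `|xi|).

Lemma gap_constant_gt0 (R : realType) (n k : nat) (xi : R) :
  (0 < n)%N -> 0 < gap_constant n k xi.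
Proof.
by move=> n0; rewrite !mulr_gt0 ?lipschitz_bound_gt0 ?exprn_gt0 // ltr_wpDl.
Qed.

(** Since L is small at xi, its constant term is close to - a xi, so the
    height of L cannot be much larger than |a|. *)
Lemma linear_height_le (R : realType) (xi : R) (L : {poly int}) :
    size L = 2 -> `|int_poly_eval L xi| <= 1 ->
  (poly_height L)%:R <= `|(L`_1)%:~R| * (1 + `|xi|).
Proof.
move=> sL v1; have a1 := norm_int_ge1 R (linear_lead_neq0 sL).
set a := `|_| in a1 *.
have ale : a <= a * (1 + `|xi|).
  by rewrite ler_peMr ?(le_trans ler01 a1) // lerDl.
have ble : `|(L`_0)%:~R| <= a * (1 + `|xi|).
  have -> : (L`_0)%:~R = int_poly_eval L xi - (L`_1)%:~R * xi.
    by rewrite linear_eval ?sL // addrC addKr.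
  apply: le_trans (ler_normB _ _) _.
  by rewrite mulrDr mulr1 normrM lerD // (le_trans v1).
have -> : (poly_height L)%:R = Num.max a `|(L`_0)%:~R|.
  rewrite /poly_height sL big_ord_recl big_ord_recl big_ord0 /= maxn0.
  rewrite /a -!intr_norm -!natr_absz maxC.
  by case: (leqP `|(L`_0)%R| `|(L`_1)%R|) => h;
   rewrite ?(maxn_idPr h) ?(maxn_idPl (ltnW h));
   [rewrite max_r|rewrite max_l]; rewrite // ler_nat // ltnW.
by rewrite ge_max ale.
Qed.

(** No algebraic number in range does better than the value of L at xi. Either
    alpha is the root r of L, and its cost dominates |a| |xi - r| = |L(xi)|, or
    the minimal polynomial of alpha takes at r a nonzero value of size at least
    H ^ (- n), which keeps alpha too far from r, hence from xi. *)
Lemma alg_cost_ge_linear_form (R : realType) (n k : nat) (xi : R)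
    (L : {poly int}) (alpha : R[i]) :
    (0 < k)%N -> size L = 2 -> zcontents L = 1 ->
    `|int_poly_eval L xi| <= 1 ->
    gap_constant n k xi * `|int_poly_eval L xi|
      * (poly_height L)%:R ^+ (n + k.-1) < 1 ->
    bounded_alg n ((2 * (poly_height L)%:R) ^+ k) alpha ->
  `|int_poly_eval L xi| <= alg_cost xi alpha.
Proof.
move=> k0 sL cL v1 gap [algal degal hal].
have mM := int_minpolyP algal; set M := int_minpoly alpha in mM.
have sM : (size M <= n.+1)%N by apply: size_int_minpoly.
have a0 := linear_lead_neq0 sL.
have a1 := norm_int_ge1 R a0.
have aH := norm_coef_le R L 1.
have Hle := linear_height_le sL v1.
move: hal; rewrite /alg_cost /alg_height -/M => hX.
set v := `|int_poly_eval L xi| in v1 gap *.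
set rho := Normc.normc _.
have rho0 : 0 <= rho by rewrite -lecR -normr_complexE normr_ge0.
have h1 : 1 <= (poly_height M)%:R :> R.
  by rewrite ler1n height_gt0 // (int_minpoly_neq0 mM).
have [Mr|Mr] := eqVneq (int_poly_eval M (- (L`_0)%:~R / (L`_1)%:~R : rat)) 0.
  have [N MLN] := primitive_linear_dvd sL cL Mr.
  rewrite MLN in mM *; have [La hLM] := minpoly_linear_factor sL mM.
  have sL2 : (size L <= 2)%N by rewrite sL.
  (* In degree 1 the Lipschitz constant is 1 for every radius, so the radius
     just needs to cover xi and alpha. *)
  have := eval_near_root (n := 1) (x := xi)
    (B := Num.max `|xi| (Normc.normc alpha)) sL2 La.
  rewrite /lipschitz_bound big_ord1 expr0 !mulr1 !le_max !lexx orbT.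
  move=> /(_ isT isT)/le_trans; apply; apply: ler_wpM2r => //.
  by rewrite ler_nat.
rewrite leNgt; apply/negP => cost_lt.
have rho_lt : rho < v by apply: le_lt_trans cost_lt; rewrite ler_peMl.
have v0 : 0 <= v by apply: normr_ge0.
set h : R := (poly_height M)%:R in hX h1 cost_lt.
set H : R := (poly_height L)%:R in gap hX aH Hle.
set a : R := `|(L`_1)%:~R| in a1 aH Hle.
have a_gt0 : 0 < a by apply: lt_le_trans a1.
pose r : R := (- L`_0)%:~R / (L`_1)%:~R.
have a0R : (L`_1)%:~R != 0 :> R by rewrite intr_eq0.
have rxi : a * `|r - xi| = v.
  rewrite /a /v -normrM linear_eval ?sL // -normrN; congr `|_|.
  by rewrite /r mulrNz; field.
have rxi_le : `|r - xi| <= v by rewrite -rxi ler_peMl.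
have Mr' : int_poly_eval M r != 0.
  apply: contra_neq Mr => Mr; apply: (fmorph_inj (ratr : rat -> R)).
  rewrite rmorph0 -int_poly_eval_rmorph -Mr; congr int_poly_eval.
  by rewrite /r mulrNz fmorph_div rmorphN /= !ratr_int.
set B := `|xi| + 2.
have B0 : 0 < B by rewrite /B ltr_wpDl.
have rB : `|r| <= B.
  rewrite -[r](subrK xi) (le_trans (ler_normD _ _)) // addrC lerD2l.
  by rewrite (le_trans rxi_le) // (le_trans v1) // ler1n.
have rhoC : rho%:C%C = `|alpha - xi%:C%C| by [].
have aB : Normc.normc alpha <= B.
  rewrite -lecR -normr_complexE -[alpha](subrK xi%:C%C).
  rewrite (le_trans (ler_normD _ _)) // -rhoC normr_complexE normc_real.
  by rewrite -rmorphD lecR addrC lerD2l (le_trans (ltW rho_lt)) //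
    (le_trans v1) // ler1n.
have Ma : int_poly_eval M alpha = 0 by case: mM.
have := eval_near_root sM Ma rB aB; rewrite -/h.
set D := lipschitz_bound n B; set sigma := Normc.normc _ => Mr_le.
have sigma_le : sigma <= rho + `|r - xi|.
  rewrite -lecR rmorphD /= -normc_real -!normr_complexE.
  rewrite (_ : alpha - r%:C%C = (alpha - xi%:C%C) - (r - xi)%:C%C).
    exact: ler_normB.
  by rewrite rmorphB /= opprB addrA subrK.
have D0 : 0 <= D.
  by rewrite sumr_ge0 // => i _; rewrite mulr_ge0 // exprn_ge0 // ltW.
have H0 : 0 < H by apply: lt_le_trans aH.
have lower : 1 <= `|int_poly_eval M r| * H ^+ n.
  apply: le_trans (eval_fraction_ge a0 sM Mr') _; rewrite -/a.
  by rewrite ler_wpM2l // lerXn2r // nnegrE ltW.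
(* E bounds the quotient of the maximal height (2 H) ^ k by |a|, so that
   h |r - xi| <= E v; the case h |alpha - xi| < v is absorbed because 1 <= E. *)
pose E : R := 2 ^+ k * H ^+ k.-1 * (1 + `|xi|).
have XE : (2 * H) ^+ k <= E * a.
  rewrite exprMn -{2}(prednK k0) exprSr /E -!mulrA.
  by rewrite ler_wpM2l ?exprn_ge0 // ler_wpM2l ?exprn_ge0 ?(ltW H0) // mulrC.
have E1 : 1 <= E.
  have H1 : 1 <= H by apply: le_trans a1 aH.
  by rewrite /E !mulr_ege1 ?exprn_ege1 ?lerDl ?H1 ?ler1n.
have hsigma : h * sigma <= 2 * E * v.
  apply: le_trans (_ : h * rho + h * `|r - xi| <= _).
    by rewrite -mulrDr ler_wpM2l // (le_trans ler01).
  have e1 : h * rho <= E * v by rewrite (le_trans (ltW cost_lt)) // ler_peMl.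
  have e2 : h * `|r - xi| <= E * v.
    by rewrite -rxi mulrA ler_wpM2r // (le_trans hX).
  by rewrite -mulrA [leRHS]mulr_natl mulr2n lerD.
suff : 1 <= gap_constant n k xi * v * H ^+ (n + k.-1) by rewrite leNgt gap.
apply: le_trans lower _.
have -> : gap_constant n k xi * v * H ^+ (n + k.-1) = D * (2 * E * v) * H ^+ n.
  by rewrite /gap_constant -/B -/D exprD exprS /E; ring.
rewrite ler_wpM2r ?exprn_ge0 ?(ltW H0) // (le_trans Mr_le) //.
by rewrite mulrAC mulrC ler_wpM2l.
Qed.

(** * The exponents at a good height *)

Lemma transcendental_neq0 (R : realType) (xi : R) :
  transcendental xi -> xi != 0.
Proof.
by move=> tr; apply/eqP => xi0; apply: tr; rewrite xi0; exact: algebraic0.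
Qed.

(** At X = (2 H) ^ k the power L ^ k bounds the polynomial minimum from above
    by |L(xi)| ^ k, while the algebraic minimum stays above |L(xi)|. *)
Lemma kappa_at_ge (R : realType) (n k : nat) (xi : R) (L : {poly int}) :
    (2 <= k <= n)%N -> transcendental xi -> size L = 2 -> zcontents L = 1 ->
    `|int_poly_eval L xi| <= 1 -> `|int_poly_eval L xi| <= `|xi| ->
    gap_constant n k xi * `|int_poly_eval L xi|
      * (poly_height L)%:R ^+ (n + k.-1) < 1 ->
  (1 - k%:R^-1) * (- ln `|int_poly_eval L xi| / ln (2 * (poly_height L)%:R))
    <= kappa_at n xi ((2 * (poly_height L)%:R) ^+ k).
Proof.
move=> /andP[k2 kn] tr sL cL v1 vxi gap.
have L0 : L != 0 by rewrite -size_poly_gt0 sL.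
have sL2 : (size L <= 2)%N by rewrite sL.
have k0 : (0 < k)%N by apply: leq_trans k2.
set v := `|int_poly_eval L xi| in v1 vxi gap *.
set H2 : R := 2 * (poly_height L)%:R; set X := H2 ^+ k.
have v0 : 0 < v by rewrite normr_gt0 transcendental_eval_neq0.
have H2gt1 : 1 < H2.
  have : 1 <= (poly_height L)%:R :> R by rewrite ler1n height_gt0.
  by rewrite /H2; lra.
have X1 : 1 < X by rewrite exprn_egt1 // -lt0n.
have lnX0 : 0 < ln X by apply: ln_gt0.
have lnXE : ln X = k%:R * ln H2 by rewrite lnXn ?(lt_trans ltr01) // mulr_natl.
have [[P0 _ _] Pmin] := best_polyP n xi (ltW X1).
have Pv : `|int_poly_eval (best_poly n xi X) xi| <= v ^+ k.
  rewrite -normrX -int_poly_evalX; apply: Pmin; split.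
  - exact: expf_neq0.
  - exact: leq_trans (size_linearX _ sL2) _.
  - by rewrite /X /H2 -natrM -natrX ler_nat height_linearX.
have av : v <= alg_cost xi (best_alg n xi X).
  rewrite /best_alg; case: xgetP => [alpha _ [alphab _]|_].
    exact: (alg_cost_ge_linear_form k0 sL cL v1 gap).
  (* Without a minimizer the number used is the default 0, whose cost is at
     least |xi|. *)
  rewrite /alg_cost sub0r -rmorphN normc_real normrN (le_trans vxi) //.
  rewrite ler_peMl //.
  rewrite ler1n height_gt0 //; apply: int_minpoly_neq0 (int_minpolyP _).
  exact: algebraic0.
have lnP : ln `|int_poly_eval (best_poly n xi X) xi| <= k%:R * ln v.
  rewrite mulr_natl -lnXn // ler_ln ?posrE ?exprn_gt0 //.
  by rewrite normr_gt0 transcendental_eval_neq0.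
have lna : ln v <= ln (alg_cost xi (best_alg n xi X)).
  by rewrite ler_ln ?posrE // (lt_le_trans v0).
rewrite /kappa_at /w_at /wstar_at opprK -mulNr -mulrDl ler_pdivlMr //.
have -> : (1 - k%:R^-1) * (- ln v / ln H2) * ln X = - (k%:R * ln v) + ln v.
  rewrite lnXE; field; rewrite pnatr_eq0 -lt0n k0 /=.
  by rewrite gt_eqF // ln_gt0.
by rewrite lerD // lerN2.
Qed.

(** Passing from a minimizer P_X of degree at most 1 to its primitive part L
    increases neither the height nor the absolute value at xi. The height of L
    is unbounded as X grows, since the linear forms of height at most N + 1 have
    a positive minimum delta at xi while |P_X(xi)| < X ^ (- w); and L is not
    constant, since a nonzero integer has absolute value at least 1. *)
Lemma exists_good_linear_form (R : realType) (xi : R) (w : R) (N : nat) :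
    transcendental xi -> 0 < w -> (w%:E < w_exponent 1 xi)%E ->
  exists L : {poly int}, [/\ size L = 2, zcontents L = 1,
    (N <= poly_height L)%N &
    ln `|int_poly_eval L xi| < - (w * ln (poly_height L)%:R)].
Proof.
move=> tr w0 ww1.
have [[D0 _ _] Dmin] : is_best_poly 1 xi N.+1%:R (best_poly 1 xi N.+1%:R).
  by apply: best_polyP; rewrite ler1n.
set delta := `|int_poly_eval _ xi| in Dmin.
have delta0 : 0 < delta by rewrite normr_gt0 transcendental_eval_neq0.
(* Beyond T one has X ^ (- w) < delta. *)
pose T : R := 1 + expR (- ln delta / w).
have [X TX wX] : exists2 X, T < X & w < w_at 1 xi X.
  have : (w%:E < ereal_sup
      [set (w_at 1 xi X)%:E | X in [set X | (T < X)%R]%classic])%E.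
    apply: lt_le_trans ww1 _; apply: ereal_inf_lbound.
    by exists [set X | T < X]%classic => //; exists T; split; rewrite ?num_real.
  by move=> /ereal_sup_gt[_ [X TX <-]]; rewrite lte_fin; exists X.
have X1 : 1 < X by apply: lt_trans TX; rewrite ltrDl expR_gt0.
have X0 : 0 < X by apply: lt_trans X1.
have lnX0 : 0 < ln X by apply: ln_gt0.
have lnXdelta : - ln delta < w * ln X.
  rewrite mulrC -ltr_pdivrMr // -[ltLHS]expRK ltr_ln ?posrE ?expR_gt0 //.
  by apply: lt_trans TX; rewrite ltrDr.
have [[P0 sP hP] _] := best_polyP 1 xi (ltW X1).
set P := best_poly 1 xi X in P0 sP hP.
have lnP : ln `|int_poly_eval P xi| < - (w * ln X).
  by move: wX; rewrite /w_at -/P -mulNr ltr_pdivlMr // ltrNr.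
pose L := zprimitive P.
have L0 : L != 0 by rewrite zprimitive_eq0.
have v0 : 0 < `|int_poly_eval L xi|.
  by rewrite normr_gt0 transcendental_eval_neq0.
have lnL : ln `|int_poly_eval L xi| < - (w * ln X).
  apply: le_lt_trans lnP; rewrite ler_ln ?posrE ?eval_zprimitive_le //.
  by rewrite normr_gt0 transcendental_eval_neq0.
have hL0 : (0 < poly_height L)%N by apply: height_gt0.
exists L; split.
- apply/eqP; rewrite eqn_leq size_zprimitive sP ltnNge.
  apply/negP => sP1; have sL1 : (size L <= 1)%N by rewrite size_zprimitive.
  have c0 : L`_0 != 0.
    by apply: contraNneq L0 => c0; rewrite (size1_polyC sL1) c0.
  move: lnL; rewrite (int_poly_evalE _ sL1) big_ord1 expr0 mulr1.
  by rewrite ltNge (le_trans _ (ln_ge0 (norm_int_ge1 R c0))) //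
    oppr_le0 mulr_ge0 // ltW.
- by rewrite zcontents_primitive P0.
- rewrite leqNgt; apply/negP => hL.
  have : delta <= `|int_poly_eval L xi|.
    apply: Dmin; split; rewrite ?size_zprimitive //.
    by rewrite ler_nat ltnW // (ltn_trans hL).
  rewrite leNgt -ltr_ln ?posrE // => /negP; apply.
  by apply: lt_trans lnL _; rewrite ltrNl.
- apply: lt_le_trans lnL _; rewrite lerN2 ler_pM2l // ler_ln ?posrE ?ltr0n //.
  by apply: le_trans hP; rewrite ler_nat height_zprimitive.
Qed.

(** * Passage to the upper limits *)

Lemma ln_eventually_ge (R : realType) (t : R) :
  exists N : nat, forall H : nat, (N <= H)%N -> t <= ln H%:R.
Proof.
exists (Num.bound (expR t)) => H NH; rewrite -[t]expRK.
have eH : expR t < H%:R.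
  apply: lt_le_trans (_ : (Num.bound (expR t))%:R <= _).
    by have := archi_boundP (expR_ge0 t).
  by rewrite ler_nat.
by rewrite ler_ln ?posrE ?expR_gt0 ?(lt_trans (expR_gt0 t)) // ltW.
Qed.

(** An auxiliary w' strictly between w and w_1(xi) pays for replacing log H by
    log (2 H) and for the constants of the gap lemma. *)
Lemma kappa_upper_ge (R : realType) (n k : nat) (xi w : R) :
    (2 <= k <= n)%N -> transcendental xi -> n%:R + k%:R - 1 < w ->
    (w%:E < w_exponent 1 xi)%E ->
  (((1 - k%:R^-1) * w)%:E <= kappa_upper n xi)%E.
Proof.
move=> hk tr mw ww1; have /andP[k2 kn] := hk.
have [w' [ww' w'w1]] : exists w', w < w' /\ (w'%:E < w_exponent 1 xi)%E.
  move: ww1; case: w_exponent => [r||] //.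
    by rewrite lte_fin => wr; exists ((w + r) / 2); rewrite lte_fin; lra.
  by move=> _; exists (w + 1); split; [lra | rewrite ltry].
pose m : R := (n + k.-1)%:R.
have mE : m = n%:R + k%:R - 1.
  by rewrite /m natrD -[k in RHS](prednK (ltnW k2)) -natr1 addrA addrK.
have m0 : 0 <= m by apply: ler0n.
have w0 : 0 < w by rewrite (le_lt_trans m0) // mE.
have w'0 : 0 < w' by apply: lt_trans ww'.
have xi0 : 0 < `|xi| by rewrite normr_gt0 transcendental_neq0.
set C := gap_constant n k xi.
have C0 : 0 < C by rewrite gap_constant_gt0 // (leq_trans _ kn) // ltnW.
apply: le_ereal_inf_tmp => _ [V [M [_ MV]] <-].
(* Each N_i settles one requirement on H: that w' log H is at least
   w log (2 H), that the gap condition C v H ^ m < 1 holds, that v <= |xi|,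
   and that (2 H) ^ k lies beyond M. *)
have [N1 HN1] := ln_eventually_ge (w * ln 2 / (w' - w)).
have [N2 HN2] := ln_eventually_ge (ln C / (w' - m)).
have [N3 HN3] := ln_eventually_ge (- ln `|xi| / w').
have [N4 HN4] := ln_eventually_ge (ln (`|M| + 1)).
have [L [sL cL]] :=
  exists_good_linear_form (maxn (maxn N1 N2) (maxn N3 N4)) tr w'0 w'w1.
set H := poly_height L; rewrite !geq_max.
move=> /andP[/andP[/HN1{HN1} wH /HN2{HN2} CH]].
move=> /andP[/HN3{HN3} xiH /HN4{HN4} MH].
move=> lnv.
have L0 : L != 0 by rewrite -size_poly_gt0 sL.
have H0 : 0 < H%:R :> R by rewrite ltr0n height_gt0.
have M0 : 0 < `|M| + 1 by rewrite ltr_wpDl.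
have mw' : m < w' by rewrite mE (lt_trans mw).
move: MH wH CH xiH; rewrite ler_ln ?posrE // !ler_pdivrMr ?subr_gt0 //.
move=> MH wH CH xiH.
set v := `|int_poly_eval L xi| in lnv.
have v0 : 0 < v by rewrite normr_gt0 transcendental_eval_neq0.
have H1 : 1 <= H%:R :> R by rewrite ler1n height_gt0.
have lnH0 : 0 <= ln H%:R :> R by apply: ln_ge0.
have wlnH0 : 0 <= w' * ln H%:R by rewrite mulr_ge0 // ltW.
have v1 : v <= 1 by rewrite -ler_ln ?posrE // ln1; lra.
have vxi : v <= `|xi| by rewrite -ler_ln ?posrE //; lra.
have gap : C * v * H%:R ^+ (n + k.-1) < 1.
  have Cv0 : 0 < C * v by apply: mulr_gt0.
  have Hm0 : 0 < H%:R ^+ (n + k.-1) :> R by apply: exprn_gt0.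
  rewrite -ltr_ln ?posrE ?(mulr_gt0 Cv0) // [ltRHS]ln1.
  rewrite lnM ?posrE // [ln (C * v)]lnM ?posrE // lnXn //.
  rewrite -[ln H%:R *+ _]mulr_natl -/m.
  lra.
have := kappa_at_ge hk tr sL cL v1 vxi gap; rewrite -/H -/v => kappa_ge.
apply: le_trans (_ : (kappa_at n xi ((2 * H%:R) ^+ k))%:E <= _)%E; last first.
  apply: ereal_sup_ubound; exists ((2 * H%:R) ^+ k) => //; apply: MV.
  apply: lt_le_trans (_ : H%:R <= _); first by have := ler_norm M; lra.
  apply: le_trans (_ : 2 * H%:R <= _); first lra.
  by rewrite ler_eXnr ?(ltnW k2) //; lra.
rewrite lee_fin; apply: le_trans kappa_ge; apply: ler_wpM2l.
  by rewrite subr_ge0 invf_le1 ?ler1n ?ltr0n ltnW.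
rewrite ler_pdivlMr; last by rewrite ln_gt0 //; lra.
rewrite lnM ?posrE //; lra.
Qed.

Lemma lee_of_reals_between (R : realType) (m : R) (x y : \bar R) :
    (m%:E < x)%E -> (forall w : R, m < w -> (w%:E < x)%E -> (w%:E <= y)%E) ->
  (x <= y)%E.
Proof.
case: x => [x||] // mx H.
- move: mx; rewrite lte_fin => mx; apply/lee_subgt0Pr => e e0.
  have := H (Num.max (x - e) ((m + x) / 2));
    rewrite lt_max lte_fin gt_max -EFinB => h.
  apply: le_trans (h _ _); first by rewrite lee_fin le_max lexx.
    by apply/orP; right; lra.
  by apply/andP; split; lra.
- case: y H => [y||] // H.
    pose t := Num.max y m + 1.
    have mt : m < t.
      by rewrite (@le_lt_trans _ _ (Num.max y m)) ?ltrDl // le_max lexx orbT.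
    have yt : y < t.
      by rewrite (@le_lt_trans _ _ (Num.max y m)) ?ltrDl // le_max lexx.
    by have := H t mt (ltry t); rewrite lee_fin leNgt yt.
  have := H (m + 1); rewrite ltry => /(_ _ isT); rewrite leeNy_eq => h.
  by have := h _; rewrite ltrDl => /(_ ltr01).
Qed.

Theorem theorem3p3 (R : realType) (n : nat) (hn : (2 <= n)%N) (xi : R)
    (hxi : transcendental xi) :
  [/\ forall k : nat, (2 <= k <= n)%N ->
        ((n%:R + k%:R - 1)%:E < w_exponent 1 xi)%E ->
        ((1 - k%:R^-1)%:E * w_exponent 1 xi <= kappa_upper n xi)%E,
      ((2 * n%:R - 1)%:E < w_exponent 1 xi)%E ->
        ((1 - n%:R^-1)%:E * w_exponent 1 xi <= kappa_upper n xi)%E &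
      Liouville_number xi -> kappa_upper n xi = +oo%E].
Proof.
have c0 k : (2 <= k)%N -> 0 < 1 - k%:R^-1 :> R.
  by move=> k2; rewrite subr_gt0 invf_lt1 ?ltr1n // ltr0n ltnW.
have main k : (2 <= k <= n)%N -> ((n%:R + k%:R - 1)%:E < w_exponent 1 xi)%E ->
    ((1 - k%:R^-1)%:E * w_exponent 1 xi <= kappa_upper n xi)%E.
  move=> hk mw1; have k0 := c0 _ (proj1 (andP hk)).
  rewrite -lee_pdivlMl //; apply: (lee_of_reals_between mw1) => w mw ww1.
  by rewrite lee_pdivlMl // -EFinM; apply: kappa_upper_ge.
have hnn : (2 <= n <= n)%N by rewrite hn leqnn.
split=> // [mw1|[_ w1]]; first by apply: main => //;
  rewrite -mulr2n -[n%:R *+ 2]mulr_natl.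
have := main n hnn; rewrite w1 ltry => /(_ isT).
by rewrite gt0_muley ?lte_fin ?c0 // leye_eq => /eqP.
Qed.
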